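(* Let $V$ be a finite-dimensional diffeological vector space. Then the following conditions on $V$ are equivalent: $V$ is fine; $V$ is projective; the smooth linear functionals on $V$ separate points; the smooth functionals on $V$ separate points; every finite-dimensional subspace of $V$ is fine. In other words, when restricted to finite-dimensional vector spaces, the collections $\mathcal{FV}$, $\mathcal{PV}$, $\mathcal{SV}$, $\mathcal{SD}$ and $\mathcal{FFV}$ of diffeological vector spaces satisfying these respective conditions agree.
   Context: A diffeological space is a set $X$ together with a specified set of functions $U\to X$ (called plots) for each open set $U\subseteq\mathbb{R}^n$ and each $n\in\mathbb{N}$, such that: (1) every constant function $U\to X$ is a plot; (2) if $U\to X$ is a plot and $V\to U$ is smooth ($V$ open in some $\mathbb{R}^m$), then the composite $V\to U\to X$ is a plot; (3) if $U=\bigcup_i U_i$ is an open cover and $U\to X$ is a function each of whose restrictions $U_i\to X$ is a plot, then $U\to X$ is a plot. A function $f:X\to Y$ between diffeological spaces is smooth if $f\circ p$ is a plot of $Y$ for every plot $p$ of $X$. $\mathbb{R}^n$ carries the standard diffeology (plots are the usual smooth maps). Subsets carry the sub-diffeology (plots are the functions that are plots of the ambient space) and products carry the product diffeology (plots are the functions all of whose components are plots). A subduction is a map $f:X\to Y$ such that the plots of $Y$ are exactly the functions $U\to Y$ that locally lift through $f$ to plots of $X$ (in particular $f$ is smooth and surjective). A diffeological vector space is a real vector space $V$ with a diffeology such that addition $V\times V\to V$ and scalar multiplication $\mathbb{R}\times V\to V$ are smooth. A subspace means a linear subspace with the sub-diffeology. $V$ is fine if its diffeology is the smallest (fewest plots)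 diffeology making the vector space $V$ a diffeological vector space. $V$ is projective if for every linear subduction $f:W_1\to W_2$ of diffeological vector spaces and every smooth linear map $g:V\to W_2$ there is a smooth linear map $h:V\to W_1$ with $g=f\circ h$. The smooth functionals (resp. smooth linear functionals) on $V$ separate points if for all $x\neq y$ in $V$ there is a smooth (resp. smooth linear) map $f:V\to\mathbb{R}$ with $f(x)\neq f(y)$. *)

(* Defs.v *)
From HB Require Import structures.
From mathcomp Require Import all_boot all_order all_algebra.
From mathcomp Require Import all_classical all_reals all_analysis.
Import Order.TTheory GRing.Theory Num.Theory.
Import numFieldNormedType.Exports.

Set Implicit Arguments.
Unset Strict Implicit.
Unset Printing Implicit Defensive.

Local Open Scope classical_set_scope.
Local Open Scope ring_scope.

(* [Ck k U f] is meant for an open [U] and a finite-dimensional domain: there,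
   being [C^(k+1)] on [U] amounts to being differentiable on [U] with all
   directional derivatives [C^k] on [U]. The values of [f] outside of [U] play
   no role. *)
Fixpoint Ck (R : realType) (E F : normedModType R) (k : nat) (U : set E)
    (f : E -> F) : Prop :=
  match k with
  | 0%N => forall x, U x -> {for x, continuous f}
  | k'.+1 => (forall x, U x -> differentiable f x) /\
             (forall v : E, Ck k' U (fun x => 'D_v f x))
  end.

Definition Cinfty (R : realType) (E F : normedModType R) (U : set E)
    (f : E -> F) : Prop :=
  forall k, Ck k U f.

(* A function [U -> X] with [U] open in [R^n] is represented by a total function
   [p : 'rV[R]_n -> X] of which only the values on [U] matter (see
   [plot_congr]). *)
Definition plots (R : realType) (X : Type) : Type :=
  forall n : nat, set 'rV[R]_n -> ('rV[R]_n -> X) -> Prop.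

Record diffeology (R : realType) (X : Type) (P : plots R X) : Prop := {
  plot_open : forall n (U : set 'rV[R]_n) p, P n U p -> open U;
  plot_congr : forall n (U : set 'rV[R]_n) p q,
    (forall u, U u -> p u = q u) -> P n U p -> P n U q;
  plot_cst : forall n (U : set 'rV[R]_n) (x : X),
    open U -> P n U (fun=> x);
  plot_comp : forall m n (V : set 'rV[R]_m) (U : set 'rV[R]_n)
      (g : 'rV[R]_m -> 'rV[R]_n) p,
    open V -> Cinfty V g -> (forall v, V v -> U (g v)) ->
    P n U p -> P m V (p \o g);
  plot_cover : forall n (I : Type) (F : I -> set 'rV[R]_n) p,
    (forall i, P n (F i) p) -> P n (\bigcup_i F i) p
}.

Section Constructions.
Variable R : realType.

Definition smooth_map (X Y : Type) (PX : plots R X) (PY : plots R Y)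
    (f : X -> Y) : Prop :=
  forall n (U : set 'rV[R]_n) p, PX n U p -> PY n U (f \o p).

(* Used with [E := R]; the general form also covers ['rV[R]_m]. *)
Definition std_plots (E : normedModType R) : plots R E :=
  fun n U p => open U /\ Cinfty U p.
Arguments std_plots E n U p : clear implicits.

Definition prod_plots (X Y : Type) (PX : plots R X) (PY : plots R Y) :
    plots R (X * Y) :=
  fun n U p => PX n U (fst \o p) /\ PY n U (snd \o p).

Definition sub_plots (X : Type) (S : pred X) (Y : subType S) (PX : plots R X) :
    plots R Y :=
  fun n U p => PX n U (\val \o p).

Definition subduction (X Y : Type) (PX : plots R X) (PY : plots R Y)
    (f : X -> Y) : Prop :=
  forall n (U : set 'rV[R]_n) (q : 'rV[R]_n -> Y), open U ->
    PY n U q <->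
    forall u, U u -> exists U' : set 'rV[R]_n,
      [/\ open U', U' u, U' `<=` U &
        exists2 p, PX n U' p & forall v, U' v -> f (p v) = q v].

Definition dvs (V : lmodType R) (P : plots R V) : Prop :=
  [/\ diffeology P,
      smooth_map (prod_plots P P) P (fun z : V * V => z.1 + z.2) &
      smooth_map (prod_plots (std_plots R) P) P
        (fun z : R * V => z.1 *: z.2)].

Definition finite_dim (V : lmodType R) : Prop :=
  exists n, inhabited (Vector.axiom n V).

Definition fine_dvs (V : lmodType R) (P : plots R V) : Prop :=
  dvs P /\
  forall Q : plots R V, dvs Q -> forall n U p, P n U p -> Q n U p.

Definition projective_dvs (V : lmodType R) (P : plots R V) : Prop :=
  forall (W1 W2 : lmodType R) (P1 : plots R W1) (P2 : plots R W2),
  dvs P1 -> dvs P2 ->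
  forall f : {linear W1 -> W2}, subduction P1 P2 f ->
  forall g : {linear V -> W2}, smooth_map P P2 g ->
  exists2 h : {linear V -> W1}, smooth_map P P1 h & forall x, g x = f (h x).

Definition linear_functionals_separate (V : lmodType R) (P : plots R V) :
    Prop :=
  forall x y : V, x <> y ->
  exists2 f : {scalar V}, smooth_map P (std_plots R) f & f x <> f y.

Definition functionals_separate (V : lmodType R) (P : plots R V) : Prop :=
  forall x y : V, x <> y ->
  exists2 f : V -> R, smooth_map P (std_plots R) f & f x <> f y.

(* Linear subspaces are the submodule structures [W] carried by a subtype of
   [V], so that [\val : W -> V] is linear and injective. *)
Definition finite_dim_subspaces_fine (V : lmodType R) (P : plots R V) : Prop :=
  forall (S : pred V) (W : subLmodType S),
  finite_dim W -> fine_dvs (@sub_plots V S W P).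

End Constructions.

(* Main.v *)
From HB Require Import structures.
Require Import Defs.
From mathcomp Require Import all_boot all_order all_algebra.
From mathcomp Require Import all_classical all_reals all_analysis.
From mathcomp Require Import freeg.
Import Order.TTheory GRing.Theory Num.Theory.
Import numFieldNormedType.Exports.

Set Implicit Arguments.
Unset Strict Implicit.
Unset Printing Implicit Defensive.

Local Open Scope classical_set_scope.
Local Open Scope ring_scope.

(** The implications run in a cycle.

    Fine implies projective: a linear map out of a finite-dimensional space is
    determined by a basis, so a linear lift is obtained by lifting the images
    of the basis vectors through the (surjective) subduction. It is smooth
    because the plots that it sends to plots form a vector space diffeology
    ([dvs_pullback]), which contains the fine one by minimality.

    Projective implies separated by smooth linear functionals: every
    diffeological vector space [V] is the image under a linear subduction of
    one whose smooth linear functionals separate points. Take the vector space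
    freely generated by the points [(n, p, u)] of all the domains of functions
    [p : R^n -> V], mapped to [V] by evaluation, [(n, p, u) |-> p u]. Give it
    the coarsest vector space diffeology for which both this map and the linear
    extension of every function that is smooth in [u] are smooth. A plot [p]
    lifts to the plot [u |-> (n, p, u)], so the map is a subduction
    ([cover_subduction]), and finitely many points are separated by smooth
    functions, so linear functionals separate ([cover_separated]). A smooth
    linear section then pulls these functionals back to [V]
    ([projective_separate]).

    Separated by smooth functionals implies every finite-dimensional subspace
    fine: separation passes to a subspace, so it suffices to treat a
    finite-dimensional space. The derivative of a smooth functional [f] at a
    fixed point [x] is again a smooth functional of the direction
    ([ddir_smooth]), since [(u, t) |-> f (x + t p(u))] is smooth for every plot
    [p]; it is linear ([ddir_linear]) since [f] is smooth on every affine
    plane. If [f] takes different values at [x] and [y], then by the mean value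
    theorem some derivative of [f] on the segment does not vanish on [y - x],
    so the smooth linear functionals separate points ([separate_linear]). In
    finite dimension they then span the dual space
    ([smooth_columns_injective]), hence coordinates are smooth, and every plot
    is a combination of constant vectors with smooth coefficients, which is a
    plot of every vector space diffeology ([linear_separate_fine]).

    The last implication takes the whole space as a subspace of itself. *)

(** * Smooth functions between normed spaces *)

Section Calculus.
Context {R : realType}.
Implicit Types E F G : normedModType R.

Lemma Ck_pointwise E F k (U : set E) (f : E -> F) :
  (forall x, U x -> Ck k [set x] f) -> Ck k U f.
Proof.
elim: k f => [|k IH] f Uf /=; first by move=> x /Uf; exact.
split=> [x /Uf[+ _]|v]; first exact.
by apply: IH => x /Uf[_]; exact.
Qed.

Lemma Ck_subset E F k (U U' : set E) (f : E -> F) :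
  U `<=` U' -> Ck k U' f -> Ck k U f.
Proof.
move=> sub; elim: k f => [|k IH] f /= => [Uf x /sub|[df Df]]; first exact: Uf.
by split=> [x /sub/df//|v]; exact: IH.
Qed.

(** Monotonicity in the order of smoothness rests on differentiable functions
    being continuous. *)
Lemma CkS E F k (U : set E) (f : E -> F) : Ck k.+1 U f -> Ck k U f.
Proof.
elim: k f => [|k IH] f [df Df].
  by move=> x Ux; apply: differentiable_continuous; exact: df.
by split=> // v; apply: IH.
Qed.

Lemma near_eq_continuous E F (f g : E -> F) (x : E) :
  (\near x, f x = g x) -> {for x, continuous f} -> {for x, continuous g}.
Proof.
move=> fg; rewrite /prop_for /continuous_at -(nbhs_singleton fg).
by apply: cvg_trans; apply: near_eq_cvg.
Qed.

(** The differential of [f] also satisfies the first order expansion of [g], and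
    such an expansion has only one linear part. *)
Lemma near_eq_differentiable E F (f g : E -> F) (x : E) :
  (\near x, f x = g x) -> differentiable f x -> differentiable g x.
Proof.
move=> fg /diff_locallyP[dfc dfx].
have gdf : g \o shift x = cst (g x) + 'd f x +o_ 0 id.
  apply/eqaddoP => e e0.
  have /eqaddoP/(_ _ e0) := dfx; rewrite -(nbhs_singleton fg).
  have {}fg : \forall h \near (0 : E), f (h + x) = g (h + x).
    have := fg; rewrite (near_shift 0 x) /=; apply: filterS => h /=.
    by rewrite subr0.
  by apply: filterS2 fg => h fgh; rewrite !fctE/= fgh.
by apply/diff_locallyP; rewrite (diff_unique dfc gdf).
Qed.

(** On an open set, smoothness depends only on the values there, since
    derivatives are local. The Leibniz and chain rules below compute
    derivatives on [U] only, and are fed to the induction through this. *)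
Lemma Ck_congr E F k (U : set E) (f g : E -> F) : open U ->
  (forall x, U x -> f x = g x) -> Ck k U f -> Ck k U g.
Proof.
move=> oU; elim: k f g => [|k IH] f g fg.
all: have fgn x : U x -> \near x, f x = g x.
1,3: by move=> Ux; near=> y; apply: fg; near: y; exact: open_nbhs_nbhs.
  by move=> Uf x Ux; apply: near_eq_continuous (fgn _ Ux) (Uf _ Ux).
move=> [df Df]; split=> [x Ux|v].
  exact: near_eq_differentiable (fgn _ Ux) (df _ Ux).
by apply: IH (Df v) => x Ux; apply: near_eq_derive; exact: fgn.
Unshelve. all: by end_near. Qed.

Lemma Ck_cst E F k (U : set E) (c : F) : Ck k U (cst c).
Proof.
elim: k c => [|k IH] c; first by move=> x _; exact: cvg_cst.
split=> [x _|v]; first exact: differentiable_cst.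
rewrite [X in Ck _ _ X](_ : _ = cst 0); first exact: IH.
by apply/funext => x; rewrite derive_cst.
Qed.

Lemma CkD E F k (U : set E) (f g : E -> F) : open U ->
  Ck k U f -> Ck k U g -> Ck k U (f \+ g).
Proof.
move=> oU; elim: k f g => [|k IH] f g.
  by move=> cf cg x Ux; apply: continuousD; [exact: cf|exact: cg].
move=> [df Df] [dg Dg]; split=> [x Ux|v].
  by apply: differentiableD; [exact: df|exact: dg].
apply: (Ck_congr oU _ (IH _ _ (Df v) (Dg v))) => x Ux.
by rewrite /= -deriveD//; apply: diff_derivable; [exact: df|exact: dg].
Qed.

(** By the Leibniz rule the derivative of a product is built from products of
    functions that are one order less smooth. *)
Lemma CkM E k (U : set E) (f g : E -> R) : open U ->
  Ck k U f -> Ck k U g -> Ck k U (f \* g).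
Proof.
move=> oU; elim: k f g => [|k IH] f g.
  by move=> cf cg x Ux; apply: continuousM; [exact: cf|exact: cg].
move=> kf kg; have [df Df] := kf; have [dg Dg] := kg; split=> [x Ux|v].
  by apply: differentiableM; [exact: df|exact: dg].
apply: (Ck_congr oU _ (CkD oU (IH _ _ (CkS kf) (Dg v)) (IH _ _ (CkS kg) (Df v)))).
by move=> x Ux; rewrite /= -deriveM//; apply: diff_derivable; [exact: df|exact: dg].
Qed.

Lemma Ck_sum E F k (U : set E) (I : Type) (r : seq I) (f : I -> E -> F) :
  open U -> (forall i, Ck k U (f i)) -> Ck k U (fun x => \sum_(i <- r) f i x).
Proof.
move=> oU kf; elim: r => [|i r IH].
  by under eq_fun do rewrite big_nil; exact: Ck_cst.
by under eq_fun do rewrite big_cons; apply: CkD.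
Qed.

Lemma Ck_linear E F k (U : set E) (f : {linear E -> F}) :
  continuous f -> Ck k U f.
Proof.
move=> cf; case: k => [x _|k]; first exact: cf.
have df x := linear_differentiable x cf.
split=> // v; rewrite [X in Ck _ _ X](_ : _ = cst (f v)); first exact: Ck_cst.
by apply/funext => x; rewrite deriveE ?diff_lin.
Qed.

Lemma rV_linear_continuous n F (f : {linear 'rV[R]_n -> F}) : continuous f.
Proof.
have -> : f = (fun y => \sum_i y 0 i *: f (delta_mx 0 i)) :> (_ -> _).
  apply/funext => y; rewrite {1}(row_sum_delta y) linear_sum.
  by apply: eq_bigr => i _; rewrite linearZ.
(* Continuity is smoothness of order 0, hence stable under finite sums. *)
move=> x; apply: (Ck_sum (k := 0) (U := setT)) => // [|i y _].
  exact: openT.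
have cy : {for y, continuous (fun z : 'rV[R]_n => z 0 i)} by exact: coord_continuous.
exact: continuous_comp cy (@scalel_continuous _ _ (f (delta_mx 0 i)) _).
Qed.

Lemma Ck_coord E m n k (U : set E) (f : E -> 'M[R]_(m, n)) i j : open U ->
  Ck k U f -> Ck k U (fun x => f x i j : R).
Proof.
elim: k f => [|k IH] f oU.
  move=> cf x Ux.
  exact: (continuous_comp (cf x Ux) (@coord_continuous _ _ _ i j _)).
move=> [df Df]; split=> [x Ux|v].
  exact: (differentiable_comp (df _ Ux) (differentiable_coord _ i j)).
apply: (Ck_congr oU _ (IH _ oU (Df v))) => x Ux /=.
by rewrite derive_mx ?mxE//; apply: diff_derivable; exact: df.
Qed.

(** The chain rule in coordinates: only the partial derivatives of [f] along
    the standard basis appear, and these are fixed functions of the base point,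
    as an induction on the order of smoothness requires. *)
Lemma derive_comp_rV E n (g : E -> 'rV[R]_n) (f : 'rV[R]_n -> R) (x v : E) :
  differentiable g x -> differentiable f (g x) ->
  'D_v (f \o g) x =
  \sum_i 'D_v g x 0 i * 'D_(delta_mx 0 i) f (g x).
Proof.
move=> dg df; rewrite deriveE; last exact: differentiable_comp.
rewrite (diff_comp dg df)/= -(deriveE v dg); set w := 'D_v g x.
rewrite [in LHS](row_sum_delta w) linear_sum.
by apply: eq_bigr => i _; rewrite linearZ/= deriveE.
Qed.

Lemma Ck_comp E n k (V : set E) (U : set 'rV[R]_n) (g : E -> 'rV[R]_n)
    (f : 'rV[R]_n -> R) :
  open V -> (forall v, V v -> U (g v)) -> Ck k V g -> Ck k U f ->
  Ck k V (f \o g).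
Proof.
move=> oV VU; elim: k f => [|k IH] f.
  move=> cg cf x Vx; apply: continuous_comp; [exact: cg|apply: cf; exact: VU].
move=> kg [df Df]; have [dg Dg] := kg; split=> [x Vx|v].
  by apply: differentiable_comp; [exact: dg|apply: df; exact: VU].
apply: (@Ck_congr _ _ _ _ (fun x =>
   \sum_i ('D_v g x 0 i * ('D_(delta_mx 0 i) f (g x))))) => //.
  by move=> x Vx; rewrite -derive_comp_rV//; [exact: dg|apply: df; exact: VU].
apply: Ck_sum => // i; apply: CkM => //; first exact: (Ck_coord _ _ oV (Dg v)).
by apply: IH (Df _); exact: CkS.
Qed.

End Calculus.

(** * Constructions of diffeological vector spaces *)

Section VectorDiffeologies.
Context {R : realType}.
Implicit Types V W : lmodType R.

Definition mk_linear V W (f : V -> W) (lf : linear f) : {linear V -> W} :=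
  HB.pack f (GRing.isLinear.Build R V W _ f lf).

Lemma dvs_intro V (P : plots R V) : diffeology P ->
  (forall n (U : set 'rV[R]_n) p q, P n U p -> P n U q -> P n U (p \+ q)) ->
  (forall n (U : set 'rV[R]_n) (c : 'rV[R]_n -> R) p,
    std_plots U c -> P n U p -> P n U (fun u => c u *: p u)) ->
  dvs P.
Proof.
move=> dP addP scaleP; split=> // n U p [Pp1 Pp2].
  exact: addP Pp1 Pp2.
exact: scaleP Pp1 Pp2.
Qed.

Lemma dvs_plotD V (P : plots R V) n (U : set 'rV[R]_n) p q : dvs P ->
  P n U p -> P n U q -> P n U (fun u => p u + q u).
Proof.
by move=> [_ addP _] Pp Pq; exact: (addP n U (fun u => (p u, q u)) (conj Pp Pq)).
Qed.

Lemma dvs_plotZ V (P : plots R V) n (U : set 'rV[R]_n) (c : 'rV[R]_n -> R) p :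
  dvs P -> std_plots U c -> P n U p -> P n U (fun u => c u *: p u).
Proof.
move=> [_ _ scaleP] Rc Pp.
exact: (scaleP n U (fun u => (c u, p u)) (conj Rc Pp)).
Qed.

Lemma dvs_plot_sum V (P : plots R V) n (U : set 'rV[R]_n) (I : Type)
    (r : seq I) (p : I -> 'rV[R]_n -> V) : dvs P -> open U ->
  (forall i, P n U (p i)) -> P n U (fun u => \sum_(i <- r) p i u).
Proof.
move=> dP oU Pp; elim: r => [|i r IH].
  by under eq_fun do rewrite big_nil; case: dP => dP _ _; exact: plot_cst.
by under eq_fun do rewrite big_cons; exact: dvs_plotD.
Qed.

Lemma std_diffeology : diffeology (@std_plots R R).
Proof.
split.
- by move=> n U p [].
- by move=> n U p q pq [oU sp]; split=> // k; exact: Ck_congr (sp k).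
- by move=> n U x oU; split=> // k; exact: Ck_cst.
- by move=> m n V U g p oV sg VU [oU sp]; split=> // k; exact: Ck_comp (sp k).
- move=> n I F p sp; split; first by apply: bigcup_open => i _; case: (sp i).
  move=> k; apply: Ck_pointwise => x [i _ Fix].
  by case: (sp i) => _ /(_ k); apply: Ck_subset => y ->.
Qed.

Lemma std_dvs : dvs (@std_plots R R).
Proof.
apply: (@dvs_intro R^o); first exact: std_diffeology.
  move=> n U p q [oU sp] [_ sq]; split=> // k.
  exact: CkD oU (sp k) (sq k).
move=> n U p q [oU sp] [_ sq]; split=> // k.
exact: CkM oU (sp k) (sq k).
Qed.

(** Linearity of [f] makes sums and multiples of plots map to sums and multiples
    of plots. *)
Lemma dvs_pullback V W (f : {linear V -> W}) (P : plots R W) : dvs P ->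
  dvs (fun n (U : set 'rV[R]_n) (p : _ -> V) => P n U (f \o p)).
Proof.
move=> dP; have [[opP congrP cstP compP coverP] _ _] := dP.
apply: dvs_intro; first split.
- by move=> n U p; exact: opP.
- by move=> n U p q pq; apply: congrP => u Uu /=; rewrite pq.
- by move=> n U x oU; exact: cstP.
- by move=> m n U' U g p oU' sg U'U; exact: compP.
- by move=> n I F p; exact: coverP.
- move=> n U p q Pp Pq; apply: congrP (dvs_plotD dP Pp Pq) => u _.
  by rewrite /= linearD.
- move=> n U c p Rc Pp; apply: congrP (dvs_plotZ dP Rc Pp) => u _.
  by rewrite /= linearZ.
Qed.

(** Together with [dvs_pullback], this gives initial diffeologies with respect
    to families of linear maps. Nonemptiness of the family ensures that plots
    have open domains. *)
Lemma dvs_bigcap V (I : Type) (P : I -> plots R V) : inhabited I ->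
  (forall i, dvs (P i)) ->
  dvs (fun n (U : set 'rV[R]_n) p => forall i, P i n U p).
Proof.
move=> [i0] dP; have diffP i : diffeology (P i) by case: (dP i).
apply: dvs_intro; first split.
- by move=> n U p /(_ i0); exact: plot_open.
- by move=> n U p q pq Pp i; apply: plot_congr (Pp i).
- by move=> n U x oU i; exact: plot_cst.
- by move=> m n U' U g p oU' sg U'U Pp i; exact: plot_comp (Pp i).
- by move=> n J F p Pp i; apply: plot_cover => // j; exact: Pp.
- by move=> n U p q Pp Pq i; exact: dvs_plotD.
- by move=> n U c p Rc Pp i; exact: dvs_plotZ.
Qed.

Lemma finite_dim_coordinates V : finite_dim V ->
  exists n (r : {linear V -> 'rV[R]_n}) (s : {linear 'rV[R]_n -> V}),
    cancel r s /\ cancel s r.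
Proof.
move=> [n [[r lr [s rK sK]]]]; exists n, (mk_linear lr).
have ls : linear s.
  by move=> a u v; apply: (can_inj rK); rewrite lr !sK.
by exists (mk_linear ls).
Qed.

(** Constant plots on the one-point space [R^0] have to lift. *)
Lemma subduction_surj (X Y : Type) (PX : plots R X) (PY : plots R Y) f :
  diffeology PY -> subduction PX PY f -> forall y, exists x, f x = y.
Proof.
move=> dY fsub y.
have /(fsub _ _ _ openT) := plot_cst dY y (@openT 'rV[R]_0).
by move=> /(_ 0 I)[U' [_ U'0 _ [p _ fp]]]; exists (p 0); exact: fp.
Qed.

(** Lifting the images of basis vectors yields a linear lift [h]. The plots of
    [W1] pulled back along [h] form a vector space diffeology, so a fine
    diffeology is contained in it, which says that [h] is smooth. *)
Lemma fine_projective V (P : plots R V) :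
  finite_dim V -> fine_dvs P -> projective_dvs P.
Proof.
move=> /finite_dim_coordinates[n [r [s [rK sK]]]] [_ Pmin].
move=> W1 W2 P1 P2 dP1 dP2 f fsub g _.
have fsurj : forall y, exists x, f x = y.
  by have [diffP2 _ _] := dP2; exact: subduction_surj diffP2 fsub.
have [w fw] := choice (fun i : 'I_n => fsurj (g (s (delta_mx 0 i)))).
have lh : linear (fun x : V => \sum_i r x 0 i *: w i).
  move=> a x y; rewrite scaler_sumr -big_split; apply: eq_bigr => i _ /=.
  by rewrite linearP !mxE scalerDl scalerA.
exists (mk_linear lh) => [|x /=].
  exact: (Pmin _ (dvs_pullback _ dP1)).
rewrite -{1}[x]rK [in LHS](row_sum_delta (r x)) !linear_sum; apply: eq_bigr => i _.
by rewrite !linearZ/= fw.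
Qed.

End VectorDiffeologies.

(** * Derivatives of smooth functionals *)

Section Functionals.
Context {R : realType} {V : lmodType R}.
Implicit Types (P : plots R V) (f : V -> R).

Lemma Cinfty_rV_linear m (F : normedModType R) (U : set 'rV[R]_m)
  (l : {linear 'rV[R]_m -> F}) : Cinfty U l.
Proof. by move=> k; apply: Ck_linear; exact: rV_linear_continuous. Qed.

Lemma std_plots_coord m (U : set 'rV[R]_m) i :
  open U -> std_plots U (fun u : 'rV[R]_m => u 0 i : R).
Proof.
move=> oU; split=> // k; apply: Ck_coord => //.
exact: (@Cinfty_rV_linear _ _ U idfun).
Qed.

Lemma affine_plot P m (L : {linear 'rV[R]_m -> V}) x : dvs P ->
  P m setT (fun u => x + L u).
Proof.
move=> dP; have [diffP _ _] := dP; apply: dvs_plotD => //.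
  by apply: plot_cst => //; exact: openT.
have PL : P m setT (fun u : 'rV[R]_m => \sum_i u 0 i *: L (delta_mx 0 i)).
  apply: dvs_plot_sum => //; first exact: openT.
  move=> i; apply: dvs_plotZ => //; first by apply: std_plots_coord; exact: openT.
  by apply: plot_cst => //; exact: openT.
apply: plot_congr PL => // u _.
rewrite [in RHS](row_sum_delta u) linear_sum.
by apply: eq_bigr => i _; rewrite linearZ.
Qed.

(** [V] has no norm, so the derivative of [f] at [x] in the direction [v] is
    taken along the line [t |-> x + t v]. *)
Definition ddir f (x v : V) : R := 'D_(1 : R) (fun t : R => f (x + t *: v)) 0.

(** Both sides are limits of the same difference quotients. This identifies
    derivatives of functions on [R^n] obtained from [f] by composing with
    plots. *)
Lemma derive_ddir (E : normedModType R) (F : E -> R) (a w : E) f x v :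
  (forall h : R, F (h *: w + a) = f (x + h *: v)) -> 'D_w F a = ddir f x v.
Proof.
move=> Ff; have Fa : F a = f x by have := Ff 0; rewrite !scale0r add0r addr0.
rewrite /ddir /derive; set D1 := (X in lim (X @ _)).
set D2 := (X in _ = lim (X @ _)).
suff -> : D1 = D2 by [].
apply/funext => h; rewrite /D1 /D2 /=.
rewrite Fa Ff scale0r !addr0.
by rewrite -[h *: 1]/(h * 1) mulr1.
Qed.

(** For a plot [p], the function [F (u, t) = f (x + t p(u))] is smooth since
    [f] is smooth and the vector space operations are; and the derivative of [f]
    along [p u] is the partial derivative of [F] in [t] at [(u, 0)]. *)
Lemma ddir_smooth P f x : dvs P -> smooth_map P (@std_plots R R) f ->
  smooth_map P (@std_plots R R) (ddir f x).
Proof.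
move=> dP sf n U p Pp; have [diffP _ _] := dP.
have oU := plot_open diffP Pp; split=> //.
(* A point of R^(n + 1) is a pair of [u] in R^n, its left part, and [t]. *)
pose U' := (@lsubmx R 1 n 1) @^-1` U.
have oU' : open U'.
  by apply: open_comp => // z _; exact: rV_linear_continuous.
pose F (z : 'rV[R]_(n + 1)) := f (x + z 0 (rshift n 0) *: p (lsubmx z)).
have [_ sF] : std_plots U' F.
  apply: (sf _ _ (fun z : 'rV[R]_(n + 1) =>
    x + z 0 (rshift n 0) *: p (lsubmx z))).
  apply: dvs_plotD => //; first exact: plot_cst.
  apply: dvs_plotZ => //; first exact: std_plots_coord.
  apply: (plot_comp diffP _ _ _ Pp) => //; exact: Cinfty_rV_linear.
pose w : 'rV[R]_(n + 1) := row_mx 0 1.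
have [A AE] : exists A : {linear 'rV[R]_n -> 'rV[R]_(n + 1)},
    forall u, A u = row_mx u 0.
  exists (mulmxr (row_mx 1%:M (0 : 'M[R]_(n, 1)))) => u.
  by rewrite /= mul_mx_row mulmx1 mulmx0.
have sD : Cinfty U ('D_w F \o A).
  move=> k; have [_ /(_ w)] := sF k.+1.
  apply: Ck_comp => //; last exact: (Cinfty_rV_linear U A k).
  by move=> u Uu; rewrite /U' /= AE row_mxKl.
move=> k; apply: (Ck_congr oU _ (sD k)) => u Uu /=.
apply: derive_ddir => h; rewrite /F AE /w scale_row_mx add_row_mx row_mxKl.
by rewrite row_mxEr scaler0 add0r addr0 !mxE mulr1.
Qed.

(** On the plane through [x] spanned by [v] and [w], the functional [f] is an
    ordinary differentiable function of two variables, whose differential is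
    linear. *)
Lemma ddir_linear P f x : dvs P -> smooth_map P (@std_plots R R) f ->
  scalar (ddir f x).
Proof.
move=> dP sf a v w.
have lL : linear (fun u : 'rV[R]_2 => u 0 0 *: v + u 0 1 *: w).
  by move=> b y z; rewrite !mxE scalerDr !scalerDl !scalerA addrACA.
pose L := mk_linear lL.
have [_ sG] := sf _ _ _ (affine_plot L x dP).
set G := f \o _ in sG.
have dG : differentiable G 0 by have [+ _] := sG 1%N; exact.
pose e0 : 'rV[R]_2 := delta_mx 0 0; pose e1 : 'rV[R]_2 := delta_mx 0 1.
have DG u : 'd G (0 : 'rV[R]_2) u = ddir f x (L u).
  rewrite -deriveE//; apply: derive_ddir => h.
  by rewrite /G /= addr0 -[u 0 0 *: v + _]/(L u) -[RHS]/(f (x + h *: L u)) -linearZ.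
have Lv : L e0 = v by rewrite /= !mxE /= scale1r scale0r addr0.
have Lw : L e1 = w by rewrite /= !mxE /= scale1r scale0r add0r.
by have := linearP ('d G (0 : 'rV[R]_2)) a e0 e1; rewrite !DG linearP Lv Lw.
Qed.

Lemma derive_along_line P f x v (t : R) : dvs P ->
  smooth_map P (@std_plots R R) f ->
  is_derive t 1 (fun s => f (x + s *: v)) (ddir f (x + t *: v) v).
Proof.
move=> dP sf.
have lL : linear (fun u : 'rV[R]_1 => u 0 0 *: v).
  by move=> b y z; rewrite !mxE scalerDl scalerA.
pose L := mk_linear lL.
have [_ sG] := sf _ _ _ (affine_plot L x dP).
set G := f \o _ in sG.
pose e : 'rV[R]_1 := const_mx 1.
have GE : (fun s => f (x + s *: v)) = G \o ( *:%R^~ e).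
  by apply/funext => s; rewrite /G /= !mxE mulr1.
apply: DeriveDef.
  rewrite GE; apply: diff_derivable; apply: differentiable_comp.
    exact: ex_diff.
  by have [+ _] := sG 1%N; exact.
apply: derive_ddir => h.
by rewrite -[h *: 1]/(h * 1) mulr1 scalerDl addrAC addrA.
Qed.

(** If all the derivatives of [f] in the direction [y - x] vanished along the
    segment from [x] to [y], then [f x = f y] by the mean value theorem. *)
Lemma separate_linear P : dvs P ->
  functionals_separate P -> linear_functionals_separate P.
Proof.
move=> dP sep x y /sep[f sf fxy].
suff [t Dt] : exists t : R, ddir f (x + t *: (y - x)) (y - x) != 0.
  exists (mk_linear (ddir_linear (x + t *: (y - x)) dP sf)).
    exact: ddir_smooth.
  move=> /= Dxy; move: Dt; rewrite -[X in X != _]/(mk_linear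
    (ddir_linear (x + t *: (y - x)) dP sf) (y - x)) linearB /= Dxy.
  by rewrite subrr eqxx.
apply: contrapT => /forallNP D0; apply: fxy.
have [|c _] := @MVT R (fun t => f (x + t *: (y - x)))
  (fun t => ddir f (x + t *: (y - x)) (y - x)) 0 1 ltr01
  (fun t _ => derive_along_line x (y - x) t dP sf).
  apply: continuous_subspaceT => t; apply: differentiable_continuous.
  by apply/derivable1_diffP; have [] := derive_along_line x (y - x) t dP sf.
have /negP/negPn/eqP -> := D0 c.
by rewrite mul0r scale1r scale0r addr0 (addrC x) subrK => /subr0_eq.
Qed.

End Functionals.

(** * Spaces separated by smooth linear functionals *)

Section LinearFunctionals.
Context {R : realType} {V : lmodType R} (P : plots R V).
Hypothesis dP : dvs P.

Lemma scalar_comb_smooth n (l : 'I_n -> V -> R) (c : 'I_n -> R) :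
  (forall i, smooth_map P (@std_plots R R) (l i)) ->
  smooth_map P (@std_plots R R) (fun x => \sum_i l i x * c i).
Proof.
move=> sl m U p Pp; have [diffP _ _] := dP; have oU := plot_open diffP Pp.
split=> // k; apply: Ck_sum => // i; apply: CkM => //; last exact: Ck_cst.
by have [_] := sl i _ _ _ Pp; exact.
Qed.

(** A column of [M] stands for a linear functional on [V], by means of the
    coordinates [r]. *)
Definition smooth_columns n (r : {linear V -> 'rV[R]_n}) m (M : 'M[R]_(n, m)) :=
  forall j, smooth_map P (@std_plots R R) (fun x => (r x *m M) 0 j).

(** A family of smooth linear functionals with a common zero [v <> 0] can be
    enlarged by a smooth functional that does not vanish on [v]. This lowers the
    dimension of the common kernel, so the process ends with a jointly injective
    family. *)
Lemma smooth_columns_injective n (r : {linear V -> 'rV[R]_n})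
    (s : {linear 'rV[R]_n -> V}) : cancel r s -> cancel s r ->
  linear_functionals_separate P ->
  exists m (M : 'M[R]_(n, m)), smooth_columns r M /\ row_free M.
Proof.
move=> rK sK sep.
suff H : forall d m (M : 'M[R]_(n, m)), (\rank (kermx M) <= d)%N ->
    smooth_columns r M ->
    exists m' (M' : 'M[R]_(n, m')), smooth_columns r M' /\ row_free M'.
  by apply: (H n 0%N 0 (rank_leq_row _)); case.
elim=> [|d IH] m M; first rewrite leqn0 mxrank_eq0 kermx_eq0 => Mfree sM.
  by exists m, M.
move=> rd sM; have [K0|/rowV0Pn[v vK v0]] := eqVneq (kermx M) 0.
  by exists m, M; split => //; rewrite -kermx_eq0 K0.
have /sep[l sl lv] : s v <> 0.
  by move=> sv0; move/eqP: v0; apply; rewrite -(sK v) sv0 linear0.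
pose a : 'cV[R]_n := \col_i l (s (delta_mx 0 i)).
have la x : l x = (r x *m a) 0 0.
  rewrite -[in LHS](rK x) [in LHS](row_sum_delta (r x)) !linear_sum mxE.
  by apply: eq_bigr => i _; rewrite !linearZ !mxE.
apply: (IH (m + 1)%N (row_mx M a)).
  rewrite -ltnS; apply: leq_trans rd; apply: rank_ltmx.
  rewrite ltmxE; apply/andP; split.
    apply/sub_kermxP; have := mulmx_ker (row_mx M a).
    by rewrite mul_mx_row -row_mx0 => /eq_row_mx[].
  apply/negP => /(submx_trans vK)/sub_kermxP; rewrite mul_mx_row -row_mx0.
  move=> /eq_row_mx[_ va]; apply: lv.
  by rewrite la sK va mxE linear0.
move=> j; under eq_fun do rewrite mul_mx_row.
have [j' -> | j' ->] := split_ordP j.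
  by under eq_fun do rewrite row_mxEl; exact: sM.
by under eq_fun do rewrite row_mxEr ord1 -la; exact: sl.
Qed.

(** A jointly injective family of linear functionals has a linear left inverse,
    so coordinates are linear combinations of smooth functionals. A plot is thus
    a combination of fixed vectors with smooth coefficients, which every vector
    space diffeology contains. *)
Lemma linear_separate_fine : finite_dim V ->
  linear_functionals_separate P -> fine_dvs P.
Proof.
move=> /finite_dim_coordinates[n [r [s [rK sK]]]] sep; split=> // Q dQ m U p Pp.
have [k [M [sM Mfree]]] := smooth_columns_injective rK sK sep.
have [diffP _ _] := dP; have [diffQ _ _] := dQ; have oU := plot_open diffP Pp.
have sr i : smooth_map P (@std_plots R R) (fun x => r x 0 i).
  rewrite (_ : (fun x => _) = fun x => \sum_j (r x *m M) 0 j * pinvmx M j i).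
    exact: scalar_comb_smooth.
  by apply/funext => x; rewrite -[in LHS](mulmxKp Mfree (r x)) mxE.
have Qp : Q m U (fun u => \sum_i r (p u) 0 i *: s (delta_mx 0 i)).
  apply: dvs_plot_sum => // i; apply: dvs_plotZ => //; first exact: sr Pp.
  exact: plot_cst.
apply: plot_congr Qp => // u Uu.
rewrite -[in RHS](rK (p u)) [in RHS](row_sum_delta (r (p u))) linear_sum.
by apply: eq_bigr => i _; rewrite linearZ.
Qed.

End LinearFunctionals.

(** * Projective spaces are separated by smooth linear functionals *)

Lemma fglift_is_linear (R : nzRingType) (K : choiceType) (M : lmodType R)
    (phi : K -> M) :
  linear (fglift phi : {freeg K / R} -> M).
Proof.
have addphi := lift_is_additive phi.
pose F : {additive {freeg K / R} -> M} :=
  HB.pack (fglift phi) (GRing.isZmodMorphism.Build _ _ _ addphi).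
have FE D : F D = \sum_(k <- dom D) coeff k D *: phi k.
  rewrite -[in LHS](freeg_sumE D) raddf_sum; apply: eq_bigr => k _.
  exact: liftU.
move=> a D E; rewrite -[fglift phi]/(F : _ -> _) raddfD; congr (_ + _).
have -> : a *: D = \sum_(k <- dom D) Freeg [:: (a * coeff k D, k)] by [].
rewrite (FE D) scaler_sumr raddf_sum.
by apply: eq_bigr => k _; rewrite scalerA; exact: liftU.
Qed.


Section FreeCover.
Context {R : realType} {V : lmodType R} (P : plots R V).

(** The generators allow every function [p], whether or not it is a plot, and
    every point [u]: domains of plots are cut out later, in the lifts. *)
Definition map_point := {n : nat & (('rV[R]_n -> V) * 'rV[R]_n)%type}.

Definition point_of n (p : 'rV[R]_n -> V) (u : 'rV[R]_n) : map_point :=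
  Tagged (fun n => (('rV[R]_n -> V) * 'rV[R]_n)%type) (p, u).

Definition smooth_on_points (phi : map_point -> R) :=
  forall n (p : 'rV[R]_n -> V), Cinfty setT (phi \o point_of p).

Lemma untag_point_of T (x0 : T) n
    (F : ('rV[R]_n -> V) * 'rV[R]_n -> T) p u :
  untag x0 F (point_of p u) = F (p, u).
Proof. exact: (untagE x0 F (erefl (tag (point_of p u)))). Qed.

(** The points [point_of p u] with [p] fixed form a component; functions
    supported on a single component suffice to separate points. *)
Definition on_component n (p : 'rV[R]_n -> V) (psi : 'rV[R]_n -> R) :
    map_point -> R :=
  untag 0 (fun qu => if qu.1 == p then psi qu.2 else 0).

Lemma on_componentE n (p : 'rV[R]_n -> V) psi u :
  on_component p psi (point_of p u) = psi u.
Proof. by rewrite /on_component (untag_point_of 0) /= eqxx. Qed.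

Lemma smooth_on_component n (p : 'rV[R]_n -> V) psi :
  Cinfty setT psi -> smooth_on_points (on_component p psi).
Proof.
move=> spsi m q.
have [mn|mn] := eqVneq m n; last first.
  rewrite (_ : _ \o _ = cst 0) => [k|]; first exact: Ck_cst.
  by apply/funext => u; rewrite /= /on_component untag_dflt.
subst m; have [->|qp] := eqVneq q p.
  rewrite (_ : _ \o _ = psi) //.
  by apply/funext => u; exact: on_componentE.
rewrite (_ : _ \o _ = cst 0) => [k|]; first exact: Ck_cst.
by apply/funext => u; rewrite /= /on_component (untag_point_of 0) /= (negbTE qp).
Qed.

(** Two points of the same component differ in some coordinate, and an affine
    function of that coordinate separates them; the indicator function of a
    component separates its points from all the others. *)
Lemma smooth_on_points_separate2 (a b : map_point) : a != b ->
  exists phi, [/\ smooth_on_points phi, phi a != 0 & phi b = 0].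
Proof.
case: a => n [p u] ab.
have [[v bE]|nb] := pselect (exists v, b = point_of p v).
  have /rowP/existsNP[j /eqP uv] : u <> v.
    by move=> uv; move/eqP: ab; apply; rewrite bE uv.
  exists (on_component p (fun w => w 0 j - v 0 j)); split.
  - apply: smooth_on_component => k; apply: CkD; [exact: openT| |exact: Ck_cst].
    by case: (std_plots_coord j (@openT 'rV[R]_n)) => _; exact.
  - by rewrite (on_componentE p) subr_eq0.
  - by rewrite bE on_componentE subrr.
exists (on_component p (cst 1)); split.
- by apply: smooth_on_component => k; exact: Ck_cst.
- by rewrite (on_componentE p) oner_eq0.
- case: b nb {ab} => m [q v] nb.
  have [mn|mn] := eqVneq m n; last by rewrite /on_component untag_dflt.
  subst m; rewrite /on_component (untag_point_of 0) /=.
  by case: eqVneq => // qp; case: nb; exists v; rewrite qp.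
Qed.

(** Multiply functions that separate [a] from one point each. *)
Lemma smooth_on_points_separate (a : map_point) (s : seq map_point) :
  a \notin s ->
  exists phi, [/\ smooth_on_points phi, phi a != 0 &
                 forall b, b \in s -> phi b = 0].
Proof.
elim: s => [_|b s IH].
  exists (cst 1); split=> //; last by rewrite oner_eq0.
  by move=> n p k; exact: Ck_cst.
rewrite inE negb_or => /andP[/smooth_on_points_separate2[chi [schi chia chib]]].
move=> /IH[phi [sphi phia phis]]; exists (chi \* phi); split.
- by move=> n p k; apply: CkM; [exact: openT|exact: schi|exact: sphi].
- by rewrite mulf_neq0.
- move=> c; rewrite inE => /predU1P[->|/phis] /=; first by rewrite chib mul0r.
  by move=> ->; rewrite mulr0.
Qed.

Definition cover_map : {linear {freeg map_point / R} -> V} :=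
  mk_linear (fglift_is_linear (fun k : map_point => (tagged k).1 (tagged k).2)).

Definition cover_functional (phi : map_point -> R) :
    {linear {freeg map_point / R} -> R^o} :=
  mk_linear (fglift_is_linear (phi : map_point -> R^o)).

(** The initial diffeology for [cover_map] (index [None]) and for the linear
    extensions of all the smooth functions (index [Some]). It is coarse enough
    for the lifts of plots in [cover_subduction] to be plots, and has enough
    smooth functionals by construction. *)
Definition cover_plots : plots R {freeg map_point / R} :=
  fun n U p => forall i : option {phi | smooth_on_points phi},
    if i is Some phi then std_plots U (cover_functional (sval phi) \o p)
    else P U (cover_map \o p).

Hypothesis dP : dvs P.

Lemma cover_dvs : dvs cover_plots.
Proof.
pose Q (i : option {phi | smooth_on_points phi}) : plots R {freeg map_point / R} :=
  fun n U p => if i is Some phi then std_plots U (cover_functional (sval phi) \o p)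
    else P U (cover_map \o p).
apply: (@dvs_bigcap _ _ _ Q); first exact: inhabits None.
case=> [phi|]; last exact: dvs_pullback.
exact: (dvs_pullback (cover_functional (sval phi)) std_dvs).
Qed.

Lemma cover_functional_smooth phi : smooth_on_points phi ->
  smooth_map cover_plots (@std_plots R R) (cover_functional phi).
Proof. by move=> sphi n U p /(_ (Some (exist _ phi sphi))). Qed.

Lemma cover_map_smooth : smooth_map cover_plots P cover_map.
Proof. by move=> n U p /(_ None). Qed.

(** A plot [q] lifts to [u |-> (n, q, u)]: a linear extension of [phi] takes on
    it the value [phi (n, q, u)], which is smooth in [u] by assumption. *)
Lemma cover_subduction : subduction cover_plots P cover_map.
Proof.
have [diffP _ _] := dP.
move=> n U q oU; split=> [Pq u Uu|lift].
  exists U; split=> //.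
  exists (fun u => Freeg [:: (1, point_of q u)]) => [|v Uv].
    case=> [[phi sphi]|].
      split=> //= k.
      apply: (Ck_congr oU _ (Ck_subset _ (sphi n q k))) => // v _ /=.
      by rewrite liftU; exact/esym/mul1r.
    apply: (plot_congr diffP _ Pq) => v _ /=.
    by rewrite liftU scale1r.
  by rewrite /= liftU scale1r.
have [W WP] := choice (fun u : {u | U u} => lift (sval u) (svalP u)).
have -> : U = \bigcup_i W i.
  apply/seteqP; split=> [u Uu|u [i _]].
    by exists (exist _ u Uu) => //; have [_ + _ _] := WP (exist _ u Uu).
  by have [_ _ WU _] := WP i; exact: WU.
apply: (plot_cover diffP) => i; have [oW _ WU [p Pp pq]] := WP i.
by apply: (plot_congr diffP pq); exact: cover_map_smooth.
Qed.

(** For a nonzero combination of generators, choose a smooth function that is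
    nonzero at one generator and vanishes at the others that occur. *)
Lemma cover_separated : linear_functionals_separate cover_plots.
Proof.
move=> D E DE.
have : D - E != 0 by rewrite subr_eq0; exact/eqP.
rewrite -dom_eq0; case: (dom (D - E)) (@uniq_dom _ _ (D - E)) (mem_dom (D - E))
  (freeg_sumE (D - E)) => // a s /= /andP[as_ _] mem sumE _.
have [phi [sphi phia phis]] := smooth_on_points_separate as_.
exists (cover_functional phi); first exact: cover_functional_smooth.
apply/eqP; rewrite -subr_eq0 -linearB -sumE linear_sum big_cons big_seq big1.
  rewrite addr0 /= liftU; apply: mulf_neq0 => //.
  by have := mem a; rewrite mem_head => /esym.
by move=> b /phis phib; rewrite /= liftU phib; exact: mulr0.
Qed.

(** The identity of a projective space lifts to a smooth linear section of the
    cover, which is injective; composing with it turns separating functionals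
    of the cover into separating functionals of the space. *)
Lemma projective_separate : projective_dvs P -> linear_functionals_separate P.
Proof.
move=> projP.
have [|h sh hK] := projP _ _ _ _ cover_dvs dP _ cover_subduction idfun.
  by move=> n U p.
move=> x y xy.
have /cover_separated[l sl lxy] : h x <> h y.
  by move=> hxy; apply: xy; have := hK x; rewrite hxy -hK.
have ll : scalar (l \o h) by move=> a u v; rewrite /= !linearP.
exists (mk_linear ll) => // n U p Pp; exact: sl (sh _ _ _ Pp).
Qed.

End FreeCover.

(** * Subspaces *)

Section Subspaces.
Context {R : realType} {V : lmodType R}.
Implicit Type P : plots R V.

Lemma sub_dvs P (S : pred V) (W : subLmodType S) :
  dvs P -> dvs (@sub_plots R V S W P).
Proof. exact: (@dvs_pullback _ _ _ (\val : {linear W -> V})). Qed.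

Lemma sub_separate P (S : pred V) (W : subLmodType S) :
  functionals_separate P -> functionals_separate (@sub_plots R V S W P).
Proof.
move=> sep x y xy; have /sep[f sf fxy] : val x <> val y by move/val_inj.
by exists (f \o val) => // n U p; exact: sf.
Qed.

Lemma finite_dim_predT (W : subLmodType (predT : pred V)) :
  finite_dim V -> finite_dim W.
Proof.
move=> [n [[r lr [s rK sK]]]]; exists n; constructor; exists (r \o val).
  by move=> a x y; rewrite /= linearP lr.
exists (fun u => @Sub V predT W (s u) isT) => u /=; last by rewrite SubK sK.
by apply: val_inj; rewrite SubK rK.
Qed.

(** Subspaces are subtypes, and [V] is not a subtype of itself: this copy stands
    for the total space in the hypothesis on subspaces. *)
Definition full_subspace := {x : V | predT x}.
HB.instance Definition _ := SubChoice.on full_subspace.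
Fact predT_submod_closed : submod_closed (predT : {pred V}). Proof. by []. Qed.
HB.instance Definition _ := GRing.SubChoice_isSubLmodule.Build R V
  (predT : pred V) full_subspace predT_submod_closed.

Lemma subspaces_fine P : dvs P -> finite_dim V ->
  finite_dim_subspaces_fine P -> fine_dvs P.
Proof.
move=> dP dimV subfine.
pose W : subLmodType (predT : pred V) := full_subspace.
have [_ Pmin] := subfine _ W (finite_dim_predT W dimV).
split=> // Q dQ m U p Pp.
have valK : \val \o (fun u => @Sub V predT W (p u) isT) = p.
  by apply/funext => u; exact: SubK.
have := Pmin _ (sub_dvs W dQ) m U (fun u => @Sub V predT W (p u) isT).
by rewrite /sub_plots valK; exact.
Qed.

End Subspaces.

(** * The equivalence *)

Theorem theorem1p2 (R : realType) (V : lmodType R) (P : plots R V)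
    (dvsP : dvs P) (findimV : finite_dim V) :
  [<-> fine_dvs P;
       projective_dvs P;
       linear_functionals_separate P;
       functionals_separate P;
       finite_dim_subspaces_fine P].
Proof.
tfae.
- exact: fine_projective.
- exact: projective_separate.
- by move=> sep x y /sep[f sf fxy]; exists f.
- move=> sep S W findimW; have dW := sub_dvs W dvsP.
  apply: linear_separate_fine => //; apply: separate_linear => //.
  exact: sub_separate.
- exact: subspaces_fine.
Qed.
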